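(* Let $X$ be a Hausdorff continuum, let $x\in X$ and let $N\ge 1$ be an integer. Then the subspace $X\setminus\{x\}$ has an $N$-point compactification if and only if $x$ is locally $N$-separating in $X$.
   Context: A Hausdorff continuum is a compact connected Hausdorff space. An $N$-point compactification of a space $Z$ is a compact Hausdorff space $\gamma Z$ containing $Z$ as a dense subspace with $|\gamma Z\setminus Z|=N$. For a space $Y$ and $x\in Y$, $C_Y(x)$ denotes the connected component of $x$ in $Y$. The point $x$ is $N$-separating in $Y$ if $Y\setminus\{x\}$ can be partitioned into $N$ pairwise disjoint sets $A_1,\dots,A_N$, each clopen in $Y\setminus\{x\}$, such that $A_i\cap C_Y(x)\neq\emptyset$ for every $i$. The point $x$ is locally $N$-separating in $X$ if there is a neighbourhood $U$ of $x$ in $X$ (a set with $x$ in its interior) such that $x$ is $N$-separating in the subspace $U$. Standing convention: all spaces considered have at least three points. *)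

(* Defs.v *)
From mathcomp Require Import all_boot.
From mathcomp Require Import all_classical topology.

Set Implicit Arguments.
Unset Strict Implicit.
Unset Printing Implicit Defensive.

Local Open Scope classical_set_scope.
Local Open Scope card_scope.

Definition hausdorff_continuum (X : topologicalType) : Prop :=
  [/\ compact [set: X], connected [set: X] & hausdorff_space X].

(* The open sets of [Z] are exactly the traces of the open sets of [G], so that
   [e] is a homeomorphism of [Z] onto the subspace [range e] of [G]. *)
Definition embedding (Z G : topologicalType) (e : Z -> G) : Prop :=
  injective e /\
  forall U : set Z, open U <-> exists2 V : set G, open V & e @^-1` V = U.

Definition is_npoint_compactification (N : nat) (Z G : topologicalType)
    (e : Z -> G) : Prop :=
  [/\ compact [set: G], hausdorff_space G, embedding e, dense (range e)
    & ~` range e #= `I_N].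

Definition has_npoint_compactification (N : nat) (Z : topologicalType) : Prop :=
  exists (G : topologicalType) (e : Z -> G), is_npoint_compactification N e.

(* [set_type A] carries the subspace topology, so [clopen] below means clopen in
   the punctured space. The [A i] are nonempty by the last condition. *)
Definition n_separating (N : nat) (Y : topologicalType) (x : Y) : Prop :=
  exists A : 'I_N -> set (set_type (~` [set x])),
    [/\ trivIset [set: 'I_N] A,
        \bigcup_i A i = [set: set_type (~` [set x])],
        forall i, clopen (A i)
      & forall i,
          (set_val @` A i) `&` connected_component [set: Y] x !=set0].

(* [exist _ x (mem_set Ux)] is the point [x] viewed in the subspace [U]. *)
Definition locally_n_separating (N : nat) (X : topologicalType) (x : X) : Prop :=
  exists (U : set X) (Ux : U x),
    nbhs x U /\
    n_separating N (exist _ x (mem_set Ux) : set_type U).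

(* Main.v *)
(* If [G] is an [N]-point compactification of [X \ {x}], collapsing the [N] points
   at infinity to [x] gives a continuous closed map [q : G -> X].  Take disjoint
   closed neighbourhoods [V i] of the points at infinity [p i]; the union of the
   [q @` V i] is the required neighbourhood of [x].  Each [q @` V i] contains a
   connected set joining [x] to another point because the quasi-component of [p i]
   in [V i], which is connected by compactness, is not reduced to [p i]: otherwise
   [V i] would contain a nonempty set clopen in [G] and missing all points at
   infinity, whose image would be clopen in [X].

   Conversely, given the sectors [A i] of a neighbourhood [U] of [x], add to
   [X \ {x}] one point per sector, with neighbourhoods the traces on the sector of
   the neighbourhoods of [x].  These new points are not isolated: were [x] not
   adherent to [A i], then [A i] would be clopen in [U] and cut the component
   of [x]. *)
Require Import Defs.
From HB Require Import structures.
From mathcomp Require Import all_boot.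
From mathcomp Require Import all_classical topology.

Set Implicit Arguments.
Unset Strict Implicit.
Unset Printing Implicit Defensive.

Local Open Scope classical_set_scope.
Local Open Scope card_scope.

(** * Quasi-components in compact Hausdorff spaces *)

Section QuasiComponent.
Context {T : topologicalType}.
Implicit Types (V D E O : set T) (p : T).

(** For closed [V] these are the relatively clopen subsets of [V], expressed through closed sets of
    [T] rather than a subspace type. *)
Definition clopen_in V D := [/\ D `<=` V, closed D & closed (V `\` D)].

Definition quasi_component V p :=
  \bigcap_(D in [set D | clopen_in V D /\ D p]) D.

Lemma clopen_inT V : closed V -> clopen_in V V.
Proof. by move=> cV; split=> //; rewrite setDv; exact: closed0. Qed.

Lemma clopen_inI V D E : clopen_in V D -> clopen_in V E -> clopen_in V (D `&` E).
Proof.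
move=> [DV cD cVD] [EV cE cVE]; split; first by move=> y [/DV].
  exact: closedI.
by rewrite setDIr; exact: closedU.
Qed.

Lemma clopen_inD V D E : clopen_in V D -> clopen_in V E -> clopen_in V (D `\` E).
Proof.
move=> VD [EV cE cVE]; have -> : D `\` E = D `&` (V `\` E).
  by case: VD => DV _ _; rewrite setDE setIDA (setIidl DV) setDE.
apply: clopen_inI => //; split=> //.
by rewrite setDD (setIidr EV).
Qed.

Lemma clopen_in_open V D O : open O -> D `<=` O -> O `<=` V -> clopen_in V D ->
  open D.
Proof.
move=> oO DO OV [_ _ cVD]; have -> : D = O `&` ~` (V `\` D).
  apply/seteqP; split=> y; first by move=> Dy; split; [exact: DO|case].
  by move=> [/OV Vy]; apply: contra_notP => nDy; split.
by apply: openI => //; exact: closed_openC.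
Qed.

Lemma quasi_component_refl V p : quasi_component V p p.
Proof. by move=> D []. Qed.

Lemma quasi_component_sub V p : closed V -> V p -> quasi_component V p `<=` V.
Proof. by move=> cV Vp y; apply; split=> //; exact: clopen_inT. Qed.

Lemma closed_quasi_component V p : closed (quasi_component V p).
Proof. by apply: closed_bigI => D [[]]. Qed.

(** If every [D] of the family left [O], the sets [D \ O] would be a filter base, the family being
    stable under intersection; a cluster point would lie in every [D], hence in [Q], but outside
    [O]. *)
Lemma quasi_component_subset_open V p O : closed V -> compact V -> V p ->
  open O -> quasi_component V p `<=` O ->
  exists D, [/\ clopen_in V D, D p & D `<=` O].
Proof.
move=> clV cV Vp oO QO; apply: contrapT => H.
set I := [set D | clopen_in V D /\ D p].
have IV : I V by split=> //; exact: clopen_inT.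
pose F := filter_from I (fun D => D `\` O).
have FF : Filter F.
  apply: filter_from_filter; first by exists V.
  move=> D E [VD Dp] [VE Ep]; exists (D `&` E).
    by split; [exact: clopen_inI|].
  by move=> y [[Dy Ey] nOy]; split; split.
have PF : ProperFilter F.
  apply: filter_from_proper => D [VD Dp]; apply: contrapT => DO0; apply: H.
  exists D; split=> // y Dy; apply: contrapT => nOy.
  by apply: DO0; exists y.
have [|y [Vy Fy]] := cV F PF; first by exists V => // y [].
have nOy : ~ O y.
  suff : (~` O) y by [].
  apply: (open_closedC oO) => B By; apply: Fy => //.
  by exists V => // z [].
apply/nOy/QO => D ID; have [[_ cD _] Dp] := ID.
by apply: cD => B By; apply: Fy => //; exists D => // z [].
Qed.

Lemma compact_hausdorff_separation (A B : set T) :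
  compact [set: T] -> hausdorff_space T ->
  closed A -> closed B -> A `&` B = set0 ->
  exists U V, [/\ open U, open V, A `<=` U, B `<=` V & U `&` V = set0].
Proof.
move=> cT hT cA cB AB0; have AB : A `<=` ~` B by exact/disjoints_subset.
have := compact_normal hT cT cA; move=> /(_ (~` B))[|C sAC CB].
  move=> y Ay; apply: open_nbhs_nbhs; split; last exact: AB.
  exact: closed_openC.
exists C°, (~` closure C); split.
- exact: open_interior.
- exact/closed_openC/closed_closure.
- by move=> y /sAC.
- by move=> y By cCy; exact: CB By.
- by apply/disjoints_subset => y /interior_subset /subset_closure; rewrite setCK.
Qed.

(** Disjoint closed pieces of [Q] lie in disjoint open sets [O1] and [O2], and some relatively
    clopen [D] around [p] lies in their union. If [p] is in [O1], then [D] cut by [O1] is again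
    relatively clopen and contains [p], so it contains [Q] and the other piece is empty. *)
Lemma connected_quasi_component V p : compact [set: T] -> hausdorff_space T ->
  closed V -> V p -> connected (quasi_component V p).
Proof.
move=> cT hT clV Vp; set Q := quasi_component V p.
have cV : compact V by exact: subclosed_compact clV cT _.
have split_Q A1 A2 : closed A1 -> closed A2 -> A1 `&` A2 = set0 ->
    Q = A1 `|` A2 -> A1 p -> A2 = set0.
  move=> c1 c2 A12 QA A1p.
  have [O1 [O2 [oO1 oO2 AO1 AO2 O12]]] :=
    compact_hausdorff_separation cT hT c1 c2 A12.
  have [||D [VD Dp DO]] := @quasi_component_subset_open V p (O1 `|` O2) clV cV Vp.
  - exact: openU.
  - by rewrite -/Q QA; exact: setUSS.
  (* Inside [D], intersecting with [O1] amounts to removing the open set [O2]; this makes the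
     relatively open piece closed. *)
  have DO1 : D `&` O1 = D `\` O2.
    apply/seteqP; split=> y [Dy].
      by move=> O1y; split=> // O2y; have : (O1 `&` O2) y by []; rewrite O12.
    by move=> nO2; split=> //; case: (DO _ Dy).
  have DO2 : D `\` O1 = D `&` O2.
    apply/seteqP; split=> y [Dy].
      by move=> nO1; split=> //; case: (DO _ Dy).
    by move=> O2y; split=> // O1y; have : (O1 `&` O2) y by []; rewrite O12.
  have VDO : clopen_in V (D `&` O1).
    case: VD => DV cD cVD; split; first by move=> y [/DV].
      by rewrite DO1; apply: closedI => //; exact: open_closedC.
    rewrite setDIr; have -> : V `\` D `|` V `\` O1 = V `\` D `|` D `\` O1.
      apply/seteqP; split=> y [[Vy ny]|[Vy ny]]; [by left| |by left|].
        by have [Dy|nDy] := pselect (D y); [right|left].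
      by right; split=> //; exact: DV.
    by apply: closedU => //; apply: closedI => //; exact: open_closedC.
  rewrite -subset0 => y A2y.
  have : (D `&` O1) y.
    have : Q y by rewrite QA; right.
    by apply; split=> //; split=> //; exact: AO1.
  by move=> [_ O1y]; have : (O1 `&` O2) y by [split=> //; exact: AO2]; rewrite O12.
move=> B [b Bb] [C oC BC] [C' cC' BC'].
have cB : closed B by rewrite BC'; apply: closedI => //; exact: closed_quasi_component.
have cQB : closed (Q `\` B).
  rewrite BC setDIr setDv set0U; apply: closedI; first exact: closed_quasi_component.
  exact: open_closedC.
have BQ : B `<=` Q by rewrite BC => y [].
have [Bp|nBp] := pselect (B p).
  have : Q `\` B = set0.
    apply: (split_Q B) => //; first by rewrite setDIK.
    by rewrite setDUK.
  by rewrite setD_eq0 => QB; apply/seteqP.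
have : B = set0.
  apply: (split_Q (Q `\` B)) => //.
  - by rewrite setIC setDIK.
  - by rewrite setUC setDUK.
  - by split=> //; exact: quasi_component_refl.
by move=> B0; move: Bb; rewrite B0.
Qed.

End QuasiComponent.

(** Were the quasi-component just [p], some relatively clopen [D] around [p] would lie in the
    interior of [V] and be open. As [p] is not isolated, [D] has another point [z], split from [p]
    by some [D1]; then [D \ D1] is a nonempty clopen set of the kind excluded by the last
    hypothesis. *)
Lemma quasi_component_nontrivial (T : topologicalType) (V : set T) (p : T) :
  compact [set: T] -> hausdorff_space T -> closed V -> nbhs p V ->
  ~ open [set p] ->
  (forall E, clopen E -> E `<=` V -> ~ E p -> E = set0) ->
  exists2 g, quasi_component V p g & g <> p.
Proof.
move=> cT hT clV Vp nop noE; apply: contrapT => Qp.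
have cV : compact V by exact: subclosed_compact clV cT _.
have QV : quasi_component V p `<=` V°.
  move=> y Qy; have -> : y = p by apply: contrapT => yp; apply: Qp; exists y.
  exact: Vp.
have [|D [VD Dp DV]] := quasi_component_subset_open clV cV (nbhs_singleton Vp) _ QV.
  exact: open_interior.
have VV : V° `<=` V by exact: interior_subset.
have oD : open D by apply: (clopen_in_open (@open_interior _ V)) VD.
have [z Dz zp] : exists2 z, D z & z <> p.
  apply: contrapT => nz; apply: nop; suff <- : D = [set p] by [].
  apply/seteqP; split=> [y Dy /=|y /= ->//].
  by apply: contrapT => yp; apply: nz; exists y.
have [D1 [[VD1 D1p] nD1z]] : exists D1, (clopen_in V D1 /\ D1 p) /\ ~ D1 z.
  apply: contrapT => H; apply: Qp; exists z => // D1 VD1.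
  by apply: contrapT => nD1z; apply: H; exists D1.
have VE : clopen_in V (D `\` D1) by exact: clopen_inD.
have DDV : D `\` D1 `<=` V° by move=> y [/DV].
suff E0 : D `\` D1 = set0 by have : (D `\` D1) z by []; rewrite E0.
apply: noE; last by case.
- split; last by case: VE.
  exact: (clopen_in_open (@open_interior _ V)) VE.
- exact: subset_trans VV.
Qed.

(** * From an [N]-point compactification to local separation *)

Lemma disjoint_closed_nbhs (T : topologicalType) (I : finType) (p : I -> T) :
  compact [set: T] -> hausdorff_space T -> injective p ->
  exists V : I -> set T,
    [/\ forall i, closed (V i), forall i, nbhs (p i) (V i)
      & trivIset [set: I] V].
Proof.
move=> cT hT injp.
have [f fP] : {f : I * I -> set T * set T & forall ij,
    [/\ nbhs (p ij.1) (f ij).1, nbhs (p ij.2) (f ij).2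
      & ij.1 != ij.2 -> (f ij).1 `&` (f ij).2 = set0]}.
  apply: (@choice _ _ (fun ij F => [/\ nbhs (p ij.1) F.1, nbhs (p ij.2) F.2
      & ij.1 != ij.2 -> F.1 `&` F.2 = set0])) => -[i j] /=.
  have [<-|ij] := eqVneq i j.
    by exists (setT, setT); split=> //; exact: filterT.
  move: hT; rewrite open_hausdorff => /(_ (p i) (p j)) [|[A B] /=].
    by apply: contra_neq ij => /injp.
  rewrite !inE => -[Ai Bj] [oA oB AB0]; exists (A, B).
  by split=> [||_]; [exact: open_nbhs_nbhs|exact: open_nbhs_nbhs|exact: AB0].
(* The choice [f] need not be symmetric, so the neighbourhood of [p i] must respect the pairs
   [(i, j)] and [(j, i)] alike. Regularity then shrinks it to a closed one. *)
have nbhsW i : nbhs (p i) [set x | forall j, ((f (i, j)).1 `&` (f (j, i)).2) x].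
  apply: (filter_forall (f := fun j => (f (i, j)).1 `&` (f (j, i)).2)) => j.
  by apply: filterI; [case: (fP (i, j))|case: (fP (j, i))].
have [V VP] : {V : I -> set T & forall i, nbhs (p i) (V i) /\
    closure (V i) `<=` [set x | forall j, ((f (i, j)).1 `&` (f (j, i)).2) x]}.
  apply: (@choice _ _ (fun i V => nbhs (p i) V /\
    closure V `<=` [set x | forall j, ((f (i, j)).1 `&` (f (j, i)).2) x])) => i.
  by have [V] := @compact_regular _ (p i) _ hT cT filterT _ (nbhsW i); exists V.
exists (fun i => closure (V i)); split=> [i|i|].
- exact: closed_closure.
- by apply: filterS (VP i).1; exact: subset_closure.
apply/trivIsetP => i j _ _ ij; rewrite -subset0 => y [Viy Vjy].
have [_ _ /(_ ij) <-] := fP (i, j); split.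
- by have [] := (VP i).2 _ Viy j.
- by have [] := (VP j).2 _ Vjy i.
Qed.

Lemma closed_set_type (X : topologicalType) (U : set X) (C : set (set_type U)) :
  closed C -> exists2 D : set X, closed D & set_val @^-1` D = C.
Proof.
move=> cC; have [D oD DC] : open (~` C) by exact: closed_openC.
by exists (~` D); [exact: open_closedC|rewrite -preimage_setC DC setCK].
Qed.

(** Open and closed sets of the subspace are traces, so [set_val] carries a relatively clopen part
    of the preimage to a relatively clopen part of [S]. *)
Lemma connected_set_type (X : topologicalType) (U S : set X) :
  S `<=` U -> connected S -> connected (set_val @^-1` S : set (set_type U)).
Proof.
move=> SU cS B [b Bb] [C [C' oC' <-] BC] [D cD BD].
have [D' cD' D'D] := closed_set_type cD.
have inU y : S y -> exists u : set_type U, set_val u = y.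
  by move=> /SU /mem_set Uy; exists (SigSub Uy).
have BS : set_val @` B = S.
  apply: cS; first by exists (set_val b), b.
  - exists C' => //; apply/seteqP; split=> [_ [u + <-]|y [Sy C'y]].
      by rewrite BC.
    by have [u uy] := inU _ Sy; exists u => //; rewrite BC; split; rewrite /preimage/= uy.
  - exists D' => //; apply/seteqP; split=> [_ [u + <-]|y [Sy D'y]].
      by rewrite BD -D'D.
    by have [u uy] := inU _ Sy; exists u => //; rewrite BD -D'D; split; rewrite /preimage/= uy.
apply/seteqP; split=> [u|u Su]; first by rewrite BC => -[].
have : (set_val @` B) (set_val u) by rewrite BS.
by move=> [v Bv /val_inj <-].
Qed.

Lemma set_val_continuous (X : topologicalType) (U : set X) :
  continuous (set_val : set_type U -> X).
Proof. exact: initial_continuous. Qed.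

(** Isolates what matters about the collapse [q]: it is a continuous surjection, injective away from
    [x], with [N] non-isolated points over [x]. It is closed, and the images of disjoint [V i] meet
    only at [x]; these images are the sectors. *)
Lemma locally_n_separating_of_fold (G X : topologicalType) (N : nat)
    (q : G -> X) (x : X) (p : 'I_N -> G) : (1 <= N)%N ->
  compact [set: G] -> hausdorff_space G -> hausdorff_space X ->
  connected [set: X] -> continuous q -> (forall y, exists g, q g = y) ->
  injective p -> (forall g, q g = x <-> exists i, g = p i) ->
  (forall g h, q g = q h -> q g <> x -> g = h) ->
  (forall i, ~ open [set p i]) ->
  locally_n_separating N x.
Proof.
move=> N0 cG hG hX cX cq surjq injp qx injq nop.
have [V [clV nV trV]] := disjoint_closed_nbhs cG hG injp.
have Vp i : V i (p i) by exact: nbhs_singleton.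
have injV i j g : V i g -> V j g -> i = j.
  by move=> Vi Vj; apply: trV => //; exists g.
have qp i : q (p i) = x by apply/qx; exists i.
have qV i g : V i g -> q g = x -> g = p i.
  by move=> Vg /qx [j gj]; rewrite gj; congr p; apply: injV Vg; rewrite gj.
have closedq C : closed C -> closed (q @` C).
  move=> cC; apply: compact_closed => //; apply: continuous_compact.
    exact: continuous_subspaceT.
  exact: subclosed_compact cC cG _.
pose U := \bigcup_i (q @` V i).
have Ux : U x by exists (Ordinal N0) => //; exists (p (Ordinal N0)).
have nU : nbhs x U.
  (* As [q] is closed, the points whose whole fibre lies in the interiors of the [V i] form an open
     set; it contains [x]. *)
  apply: (@filterS _ _ _ (~` (q @` (~` \bigcup_i (V i)°)))).
    move=> y ny; have [g gy] := surjq y.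
    have [i _ /interior_subset Vg] : (\bigcup_i (V i)°) g.
      by apply: contrapT => ng; apply: ny; exists g.
    by exists i => //; exists g.
  apply: open_nbhs_nbhs; split.
    apply/closed_openC/closedq/open_closedC/bigcup_open => i _.
    exact: open_interior.
  by move=> [g ng /qx [i gi]]; apply: ng; exists i => //; rewrite gi; exact: nV.
exists U, Ux; split=> //.
set xU := exist _ x (mem_set Ux) : set_type U.
(* Points of the punctured neighbourhood live in a doubly nested subspace; [v] reads them in [X]. *)
pose v (z : set_type (~` [set xU])) : X := set_val (set_val z).
have vx z : v z <> x.
  move=> vzx; have /set_mem := valP z; apply.
  exact: val_inj.
have cv : continuous v.
  by move=> z; apply: continuous_comp; exact: set_val_continuous.
pose A i := v @^-1` (q @` V i).
have injA i j z : A i z -> A j z -> i = j.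
  move=> [g Vg gz] [h Vh hz]; apply: (injV _ _ g) => //.
  by rewrite (injq g h) // gz // => /vx.
have clA i : closed (A i).
  by move/continuous_closedP : cv; apply; exact: closedq.
have coverA z : exists i, A i z.
  by have /set_mem [i _ qi] := valP (set_val z); exists i.
exists A; split.
- by move=> i j _ _ [z [Ai Aj]]; exact: injA Ai Aj.
- by apply/seteqP; split=> // z _; have [i Ai] := coverA z; exists i.
- move=> i; split=> //.
  (* In a finite partition into closed sets, each set is also open. *)
  have -> : A i = ~` \bigcup_(j in [set j | j <> i]) A j.
    apply/seteqP; split=> z; first by move=> Ai [j /= ji Aj]; exact/ji/(injA _ _ z).
    move=> nz; have [j Aj] := coverA z; suff <- : j = i by [].
    by apply: contrapT => ji; apply: nz; exists j.
  by apply: closed_openC; apply: closed_bigcup => //; exact: finite_finset.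
move=> i.
have [||g Qg gp] := @quasi_component_nontrivial G (V i) (p i) cG hG (clV i) (nV i).
- exact: nop.
- move=> E [oE cE] EV nEp.
  have nqE g : E g -> q g <> x by move=> Eg /(qV _ _ (EV _ Eg)) gp; apply: nEp; rewrite -gp.
  (* [E] avoids the fibre over [x], so it is saturated and its image is the complement of the closed
     set [q @] (~[E)]. *)
  have oqE : open (q @` E).
    suff -> : q @` E = ~` (q @` (~` E)).
      exact/closed_openC/closedq/open_closedC.
    apply/seteqP; split=> y.
      move=> [g Eg <-] [h nEh hg]; apply: nEh.
      by rewrite -(injq g h) //; exact: nqE.
    have [g <-] := surjq y => ng; exists g => //.
    by apply: contrapT => nEg; apply: ng; exists g.
  rewrite -subset0 => g Eg.
  have qET : q @` E = [set: X].
    apply: cX; first by exists (q g), g.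
    - by exists (q @` E) => //; rewrite setTI.
    - by exists (q @` E); [exact: closedq|rewrite setTI].
  by have [h Eh /(nqE _ Eh)] : (q @` E) x by rewrite qET.
set S := q @` quasi_component (V i) (p i).
have QV : quasi_component (V i) (p i) `<=` V i by exact: quasi_component_sub.
have SU : S `<=` U by move=> _ [h Qh <-]; exists i => //; exists h => //; exact: QV.
have Sx : S x by exists (p i) => //; exact: quasi_component_refl.
have cS : connected S.
  apply: connected_continuous_connected; last exact: continuous_subspaceT.
  exact: connected_quasi_component.
have Ug : U (q g) by apply: SU; exists g.
have ngx : q g <> x by move=> /(qV _ _ (QV _ Qg)).
pose y : set_type U := SigSub (mem_set Ug).
have nyx : (~` [set xU]) y by move=> /(congr1 val).
exists y; split.
  by exists (SigSub (mem_set nyx)) => //; exists g => //; exact: QV.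
apply: (connected_component_max _ _ (connected_set_type SU cS)) => //.
by exists g.
Qed.

Lemma compact_set_type (X : topologicalType) (A C : set X) :
  compact C -> C `<=` A -> compact (set_val @^-1` C : set (set_type A)).
Proof.
move=> cC CA F PF FC.
have [|y [Cy Fy]] := cC (set_val @ F) _; first exact: FC.
have Ay : y \in A by apply/mem_set/CA.
exists (SigSub Ay); split=> // B D FB [_ [[W oW <-] Wy WD]].
have FvB : F (set_val @^-1` (set_val @` B)).
  by apply: filterS FB; exact: preimage_image.
have [|_ [[b Bb <-] Wb]] := Fy _ W FvB; first exact: open_nbhs_nbhs.
by exists b; split=> //; exact: WD.
Qed.

Lemma npoint_compactification_locally_separating (X : topologicalType) (x : X)
    (N : nat) : hausdorff_continuum X -> (1 <= N)%N ->
  has_npoint_compactification N (set_type (~` [set x])) ->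
  locally_n_separating N x.
Proof.
move=> [cX coX hX] N0 [G [e [cG hG [inje oe] de rN]]].
(* On [range e] this is the inverse of [e]; the default value [x] collapses the remainder. *)
pose q g : X :=
  if pselect (exists z, e z = g) is left H then set_val (projT1 (cid H)) else x.
have q_e z : q (e z) = set_val z.
  rewrite /q; case: pselect => [H|[]]; last by exists z.
  by case: cid => w /= /inje ->.
have q_out g : ~ range e g -> q g = x.
  by move=> ng; rewrite /q; case: pselect => // H; case: ng; case: H => z; exists z.
have val_x (z : set_type (~` [set x])) : set_val z <> x.
  by have /set_mem := valP z.
have [f [fN injf surjf]] := card_set_bijP rN.
have [p pP] : {p : 'I_N -> G & forall i, (~` range e) (p i) /\ f (p i) = i :> nat}.
  apply: (@choice _ _ (fun (i : 'I_N) g => (~` range e) g /\ f g = i :> nat)) => i.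
  by have [|g ng fg] := surjf i; [exact: ltn_ord|exists g].
have qx g : q g = x <-> exists i, g = p i.
  split=> [qgx|[i ->]]; last by apply: q_out; case: (pP i).
  have ng : (~` range e) g by move=> [z _ zg]; apply: (val_x z); rewrite -q_e zg.
  exists (Ordinal (fN _ ng)); apply: injf; rewrite ?inE//.
  - by case: (pP (Ordinal (fN _ ng))).
  - by case: (pP (Ordinal (fN _ ng))) => _ ->.
have ce : continuous e.
  by apply/continuousP => V oV; apply/oe; exists V.
have orange : open (range e).
  rewrite -closedC; apply: (accessible_finite_set_closed.1 (hausdorff_accessible hG)).
  by exists N.
apply: (@locally_n_separating_of_fold G X N q x p) => //.
- apply/continuousP => O oO; have [Ox|nOx] := pselect (O x).
    have -> : q @^-1` O = ~` (e @` (set_val @^-1` (~` O))).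
      apply/seteqP; split=> g.
        by move=> Og [z nOz zg]; apply: nOz; rewrite /= -q_e zg.
      move=> ng; have [[z _ zg]|/q_out qgx] := pselect (range e g); last first.
        by rewrite /= qgx.
      apply: contrapT => nO; apply: ng; exists z => //= Oz.
      by apply: nO; rewrite /= -zg q_e.
    apply: closed_openC; apply: compact_closed => //; apply: continuous_compact.
      exact: continuous_subspaceT.
    apply: compact_set_type; last by move=> y nOy /= yx; apply: nOy; rewrite yx.
    by apply: subclosed_compact cX _ => //; exact: open_closedC.
  have [V oV VO] : exists2 V : set G, open V & e @^-1` V = set_val @^-1` O.
    by apply/oe; move/continuousP: (@set_val_continuous X (~` [set x])); apply.
  have -> : q @^-1` O = V `&` range e.
    apply/seteqP; split=> g.
      move=> Og; have [[z _ zg]|/q_out qgx] := pselect (range e g); last first.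
        by move: Og; rewrite /= qgx.
      split; last by exists z.
      rewrite -zg; suff : (e @^-1` V) z by [].
      by rewrite VO /= -q_e zg.
    move=> [Vg [z _ zg]]; rewrite /= -zg q_e.
    suff : (set_val @^-1` O) z by [].
    by rewrite -VO /= zg.
  exact: openI.
- move=> y; have [->|yx] := pselect (y = x).
    by exists (p (Ordinal N0)); apply/qx; exists (Ordinal N0).
  have yx' : y \in ~` [set x] by exact/mem_set.
  by exists (e (SigSub yx')); rewrite q_e.
- by move=> i j pij; apply: val_inj; rewrite /= -(pP i).2 -(pP j).2 pij.
- move=> g h qgh qgx.
  have [[z _ zg]|/q_out//] := pselect (range e g).
  have [[w _ wh]|/q_out qhx] := pselect (range e h); last by rewrite qgh qhx in qgx.
  rewrite -zg -wh; congr e; apply: val_inj.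
  by move: qgh; rewrite -zg -wh !q_e.
- move=> i op; have [||g [-> pr]] := de [set p i] => //.
    by exists (p i).
  by case: (pP i).
Qed.

(** * Adding one end per sector *)

Section EndCompactification.
Context {X : topologicalType} (x : X) (N : nat).

Local Notation Z := (set_type (~` [set x])).

(* [B] is a phantom parameter: it determines the topology put on [end_type B]. *)
Definition end_type (B : 'I_N -> set X) : Type := (Z + 'I_N)%type.

Context (B : 'I_N -> set X).
Local Notation G := (end_type B).

Definition end_fold (g : G) : X :=
  match g with inl z => set_val z | inr _ => x end.

Definition end_sector (i : 'I_N) : set G := fun g =>
  match g with inl z => B i (set_val z) | inr j => i = j end.

Definition end_cell (g : G) : set G :=
  match g with inl _ => setT | inr i => end_sector i end.

(** Basic neighbourhoods of [g] are preimages of neighbourhoods of [end_fold g], cut down to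
    [end_cell g]. The cut distinguishes the ends, which all lie over [x]. *)
Definition end_open : set_system G := [set O | forall g, O g ->
  exists2 W, nbhs (end_fold g) W & end_fold @^-1` W `&` end_cell g `<=` O].

Let end_openT : end_open setT.
Proof. by move=> g _; exists setT => //; exact: filterT. Qed.

Let end_openI : setI_closed end_open.
Proof.
move=> O P oO oP g [Og Pg]; have [W nW WO] := oO g Og; have [W' nW' WP] := oP g Pg.
exists (W `&` W'); first exact: filterI.
by move=> h [[Wh W'h] ch]; split; [exact: WO|exact: WP].
Qed.

Let end_open_bigU (I : Type) (f : I -> set G) :
  (forall i, end_open (f i)) -> end_open (\bigcup_i f i).
Proof.
move=> of_ g [i _ fig]; have [W nW Wf] := of_ i g fig.
by exists W => // h /Wf fih; exists i.
Qed.

HB.instance Definition _ := Choice.on G.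
HB.instance Definition _ :=
  isOpenTopological.Build G end_openT end_openI end_open_bigU.

Lemma end_openE (O : set G) : open O = end_open O.
Proof. by []. Qed.

Lemma end_fold_continuous : continuous end_fold.
Proof.
apply/continuousP => O oO; rewrite end_openE => g Og; exists O.
  exact: open_nbhs_nbhs.
by move=> h [].
Qed.

Context (oB : forall i, open (B i)) (xB : forall i, ~ B i x)
  (trB : trivIset setT B).

Lemma open_end_sector i : open (end_sector i).
Proof.
rewrite end_openE => -[z Bz|j /= <-].
  exists (B i); first exact: open_nbhs_nbhs.
  by move=> [w|j] [] //= /xB.
by exists setT; [exact: filterT|move=> h []].
Qed.

Lemma trivIset_end_sector : trivIset setT end_sector.
Proof.
move=> i j _ _ [[z|k] /= []]; last by move=> -> ->.
by move=> Bi Bj; apply: trB => //; exists (set_val z).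
Qed.

(** Points that cannot be separated have the same image in [X]; only two ends can then differ, and
    their open sectors are disjoint. *)
Lemma end_hausdorff : hausdorff_space X -> hausdorff_space G.
Proof.
move=> hX g h gh; have qgh : end_fold g = end_fold h.
  apply: hX => P Q nP nQ.
  have [k [Pk Qk]] := gh _ _ (end_fold_continuous nP) (end_fold_continuous nQ).
  by exists (end_fold k).
case: g h gh qgh => [z|i] [w|j] gh /=.
- by move=> /val_inj ->.
- by move=> zx; case: (set_mem (valP z)).
- by move=> wx; case: (set_mem (valP w)); exact: esym.
move=> _; congr inr; apply: trivIset_end_sector => //; apply: gh.
  by apply: open_nbhs_nbhs; split=> //; exact: open_end_sector.
by apply: open_nbhs_nbhs; split=> //; exact: open_end_sector.
Qed.

Lemma end_compact : compact [set: X] -> nbhs x (x |` \bigcup_i B i) ->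
  compact [set: G].
Proof.
move=> cX nV; rewrite compact_ultra => F FU _.
have [y Fy] : exists y : X, end_fold @ F --> y.
  have [|y [_ Fy]] := cX (end_fold @ F) _; first exact: filterT.
  exists y => W nW.
  have [//|nFW] := in_ultra_setVsetC (end_fold @^-1` W) FU.
  by have [k [+ Wk]] := Fy (~` W) W nFW nW.
suff [g [gy Fg]] : exists g, end_fold g = y /\ F (end_cell g).
  exists g; split=> // O [P [oP Pg PO]]; have [W nW WP] := oP g Pg.
  apply: (filterS (subset_trans WP PO)); apply: filterI => //.
  by apply: Fy; rewrite -gy.
have [yx|yx] := pselect (y = x); last first.
  by exists (inl (SigSub (mem_set (yx : (~` [set x]) y)))); split=> //; exact: filterT.
suff [i Fi] : exists i, F (end_sector i) by exists (inr i).
apply: contrapT => nF.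
have FC : F [set g | forall i, (~` end_sector i) g].
  apply: (filter_forall (f := fun i => ~` end_sector i)) => i.
  have [Fi|//] := in_ultra_setVsetC (end_sector i) FU.
  by case: nF; exists i.
have FV : F (end_fold @^-1` (x |` \bigcup_i B i)) by apply: Fy; rewrite yx.
have [[z|i] [nz Vz]] := filter_ex (filterI FC FV); last exact: (nz i).
case: Vz => [zx|[i _ Bz]]; last exact: (nz i).
by have /set_mem := valP z.
Qed.

Lemma embedding_inl : embedding (inl : Z -> G).
Proof.
split=> [z w []//|U]; split=> [[V oV <-]|[V oV <-]].
  exists (end_fold @^-1` V) => //.
  by move/continuousP: end_fold_continuous; apply.
rewrite openE => z Vz; have [W nW WV] := oV (inl z) Vz.
have : nbhs z (set_val @^-1` W) by exact: set_val_continuous.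
by apply: filterS => w Ww; exact: WV.
Qed.

Lemma dense_inl : (forall i, closure (B i) x) ->
  dense (range (inl : Z -> G)).
Proof.
move=> clB O [[z|i] Og] oO; first by exists (inl z); split=> //; exists z.
have [W nW WO] := oO _ Og; have [y [By Wy]] := clB i W nW.
have yx : (~` [set x]) y by move=> /= yx; apply: (xB (i := i)); rewrite -yx.
exists (inl (SigSub (mem_set yx))); split; last by exists (SigSub (mem_set yx)).
by apply: WO.
Qed.

Lemma card_ends : ~` range (inl : Z -> G) #= `I_N.
Proof.
(* The value [0] is a default: only ends lie outside the range of [inl]. *)
apply/card_set_bijP; exists (fun g => if g is inr i then val i else 0%N); split.
- by move=> [z|i] ng; [case: ng; exists z|exact: ltn_ord].
- move=> [z|i] [w|j] /set_mem ng /set_mem nh.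
  + by case: ng; exists z.
  + by case: ng; exists z.
  + by case: nh; exists w.
  + by move=> /val_inj ->.
- by move=> n nN; exists (inr (Ordinal (nN : (n < N)%N))) => // -[].
Qed.

End EndCompactification.

(** * From local separation to an [N]-point compactification *)

Lemma locally_separating_npoint_compactification (X : topologicalType) (x : X)
    (N : nat) : hausdorff_continuum X -> locally_n_separating N x ->
  has_npoint_compactification N (set_type (~` [set x])).
Proof.
move=> [cX coX hX] [U [Ux [nU [A [trA covA clA AC]]]]].
set xU := exist _ x (mem_set Ux) : set_type U.
rewrite -/xU in AC.
have clx : closed [set x] by exact: accessible_closed_set1 (hausdorff_accessible hX) x.
have oC : open (~` [set x]) by exact: closed_openC.
pose v (z : set_type (~` [set xU])) : X := set_val (set_val z).
have injv : injective v by move=> z w /val_inj /val_inj.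
have vx z : v z <> x.
  by move=> vzx; have /set_mem := valP z; apply; exact: val_inj.
have surjv y : U y -> y <> x -> exists z, v z = y.
  move=> Uy yx; pose u : set_type U := SigSub (mem_set Uy).
  have ux : (~` [set xU]) u by move=> /(congr1 val).
  by exists (SigSub (mem_set ux)).
(* [A i] is open only relative to [U]; cutting by the interior of [U] makes the sector open in
   [X]. *)
pose B i := U° `&` v @` A i.
have UU : U° `<=` U by exact: interior_subset.
have coverA z : exists i, A i z.
  have [i _ Ai] : (\bigcup_i A i) z by rewrite covA.
  by exists i.
have openA i : exists2 E, open E & forall z, A i z <-> E (v z).
  have [_ [E oE <-] <-] : open (A i) by case: (clA i).
  by exists E.
have [E oE AE] : {E : 'I_N -> set X & (forall i, open (E i)) &
    forall i z, A i z <-> E i (v z)}.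
  have [E EP] := @choice _ _ (fun i E => open E /\ forall z, A i z <-> E (v z))
    (fun i => let: ex_intro2 E oE AE := openA i in ex_intro _ E (conj oE AE)).
  by exists E => i; case: (EP i).
have oB i : open (B i).
  have -> : B i = U° `&` (~` [set x] `&` E i).
    apply/seteqP; split=> y.
      by move=> [Uy [z /AE Ez zy]]; rewrite -zy in Uy *; split=> //; split=> //; exact: vx.
    move=> [Uy [yx Ey]]; split=> //; have [z zy] := surjv y (UU _ Uy) yx.
    by exists z => //; apply/AE; rewrite zy.
  by apply: openI; [exact: open_interior|exact: openI].
have xB i : ~ B i x by move=> [_ [z _ /vx]].
have trB : trivIset setT B.
  move=> i j _ _ [y [[_ [z Az zy]] [_ [w Aw wy]]]].
  apply: trA => //; exists z; split=> //.
  by rewrite (injv z w) // zy wy.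
have clB i : closure (B i) x.
  move=> W nW; apply: contrapT => BW.
  pose D : set (set_type U) := set_val @` A i.
  have DE u : D u <-> E i (set_val u) /\ set_val u <> x.
    split=> [[z Az <-]|[Eu ux]]; first by split; [exact/AE|exact: vx].
    have [z zu] := surjv (set_val u) (set_mem (valP u)) ux.
    by exists z; [apply/AE; rewrite zu|exact: val_inj].
  have oD : open D.
    exists (E i `&` ~` [set x]); first exact: openI.
    by apply/seteqP; split=> u; rewrite DE.
  have cD : closed D.
    rewrite -openC.
    (* The complement of [D] is open: near [x] it contains the trace of [W], which misses [B i], and
       away from [x] it consists of the other sectors. *)
    exists ((U° `&` W°) `|` \bigcup_(j in [set j | j <> i]) (E j `&` ~` [set x])).
      apply: openU; first by apply: openI; exact: open_interior.
      by apply: bigcup_open => j _; exact: openI.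
    apply/seteqP; split=> u.
      move=> [[Uu Wu] [z Az zu]|[j ji [Ej ux]] [z Az zu]].
        apply: BW; exists (set_val u); split; last exact: interior_subset.
        by split=> //; exists z => //; rewrite -zu.
      apply: ji; apply: trA => //; exists z; split=> //.
      by apply/AE; rewrite /v zu.
    move=> nDu; have [ux|ux] := pselect (set_val u = x).
      by left; rewrite /= ux; split=> //; exact: nbhs_interior.
    have [z zu] := surjv (set_val u) (set_mem (valP u)) ux.
    have [j Aj] := coverA z; right; exists j => /=.
      by move=> ji; apply: nDu; exists z; [rewrite -ji|exact: val_inj].
    by split=> //; rewrite -zu; exact/AE.
  set C := connected_component [set: set_type U] xU in AC.
  (* [D] is clopen and meets the component [C], so it contains [C]; yet [xU] is in [C] and not in
     [D]. *)
  have CD : C `&` D = C.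
    have cC : connected C by exact: component_connected.
    apply: cC.
    - by have [u [Du Cu]] := AC i; exists u.
    - by exists D.
    - by exists D.
  have : C xU by exact: connected_component_refl.
  by rewrite -CD => -[_ /DE []].
exists (end_type x B), inl; split.
- apply: end_compact => //; apply: filterS (nbhs_interior nU) => y Uy.
  have [->|yx] := pselect (y = x); [by left|right].
  have [z zy] := surjv y (UU _ Uy) yx; have [i Ai] := coverA z.
  by exists i => //; split=> //; exists z.
- exact: end_hausdorff.
- exact: embedding_inl.
- exact: dense_inl.
- exact: card_ends.
Qed.

Theorem lemma4p8 (X : topologicalType) (hX : hausdorff_continuum X)
    (hX3 : `I_3 #<= [set: X]) (x : X) (N : nat) (hN : (1 <= N)%N) :
  has_npoint_compactification N (set_type (~` [set x])) <->
  locally_n_separating N x.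
Proof.
split; first exact: npoint_compactification_locally_separating.
exact: locally_separating_npoint_compactification.
Qed.
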